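(* For every semiring $S$, the semisubtractive space $\mathcal{I}_s(S)$ is sober.
   Context: A semiring $S$ means a commutative semiring with multiplicative identity $1$, with $0\neq 1$. An ideal of $S$ is an additive submonoid $\mathfrak{a}$ of $S$ with $sx\in\mathfrak{a}$ for all $s\in S$, $x\in\mathfrak{a}$. $\mathcal{V}(S)$ denotes the set of elements $x\in S$ having an additive inverse $-x$ in $S$. An ideal $\mathfrak{a}$ is semisubtractive if $x\in\mathfrak{a}\cap\mathcal{V}(S)$ implies $-x\in\mathfrak{a}\cap\mathcal{V}(S)$; $\mathcal{I}_s(S)$ is the set of semisubtractive ideals of $S$. The semisubtractive space $\mathcal{I}_s(S)$ is this set with the topology having as subbasic closed sets the sets $\mathcal{H}(\mathfrak{a}):=\{\mathfrak{b}\in\mathcal{I}_s(S)\mid\mathfrak{b}\supseteq\mathfrak{a}\}$, $\mathfrak{a}\in\mathcal{I}_s(S)$. A topological space is sober if every nonempty irreducible closed subset $D$ has a unique generic point, i.e. a unique $x\in D$ with $D=\overline{\{x\}}$. *)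

(* Defs.v *)
From HB Require Import structures.
From mathcomp Require Import all_boot all_algebra.
From mathcomp Require Import boolp classical_sets topology_structure.

Set Implicit Arguments.
Unset Strict Implicit.
Unset Printing Implicit Defensive.

Import GRing.Theory.
Local Open Scope classical_set_scope.
Local Open Scope ring_scope.

Section Ideals.
Variable S : comNzSemiRingType.
Implicit Types (a : set S) (s x y : S).

Definition is_ideal a : Prop :=
  [/\ a 0,
      (forall x y, a x -> a y -> a (x + y)) &
      (forall s x, a x -> a (s * x))].

Definition invertibles : set S := [set x | exists y, x + y = 0].

(* There is no opposite in a semiring: [- x] is the [y], necessarily unique,
   such that [x + y = 0]. *)
Definition is_semisubtractive a : Prop :=
  forall x y, x + y = 0 ->
    (a `&` invertibles) x -> (a `&` invertibles) y.

End Ideals.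

Record semisubtractive_ideal (S : comNzSemiRingType) := SemisubtractiveIdeal {
  ideal_set :> set S;
  ideal_setP : is_ideal ideal_set;
  ideal_set_semisubtractive : is_semisubtractive ideal_set
}.

Section Space.
Variable S : comNzSemiRingType.

Definition hull (a : semisubtractive_ideal S) : set (semisubtractive_ideal S) :=
  [set b : semisubtractive_ideal S | (a : set S) `<=` b].

Lemma is_ideal_setT : is_ideal [set: S].
Proof. by []. Qed.

Lemma is_semisubtractive_setT : is_semisubtractive [set: S].
Proof. by move=> x y xy0 _; split=> //; exists x; rewrite addrC. Qed.

HB.instance Definition _ := gen_eqMixin (semisubtractive_ideal S).
HB.instance Definition _ := gen_choiceMixin (semisubtractive_ideal S).
HB.instance Definition _ := isPointed.Build (semisubtractive_ideal S)
  (SemisubtractiveIdeal is_ideal_setT is_semisubtractive_setT).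

(* [isSubBaseTopological] takes a subbase of open sets, hence the complements
   of the subbasic closed sets [hull a]. *)
HB.instance Definition _ := isSubBaseTopological.Build (semisubtractive_ideal S)
  [set: semisubtractive_ideal S] (fun a => ~` hull a).

End Space.

Definition irreducible_set (T : topologicalType) (D : set T) : Prop :=
  forall A B : set T, closed A -> closed B ->
    D `<=` A `|` B -> D `<=` A \/ D `<=` B.

Definition generic_point (T : topologicalType) (D : set T) (x : T) : Prop :=
  D x /\ D = closure [set x].

Definition sober (T : topologicalType) : Prop :=
  forall D : set T, D !=set0 -> irreducible_set D -> closed D ->
    exists! x : T, generic_point D x.

(* Main.v *)
Require Import Defs.
From HB Require Import structures.
From mathcomp Require Import all_boot all_algebra.
From mathcomp Require Import boolp classical_sets topology_structure.
From mathcomp Require Import filter.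

(** Order the semisubtractive ideals by inclusion.  The closure of a point [x]
is its up-set [hull x] ([closure_ideal]): it is contained in the closed set
[hull x], and conversely an ideal that contains [x] lies in every subbasic
closed set in which [x] lies.  Since [hull x] determines [x], generic points
are unique.

For existence, semisubtractive ideals are closed under arbitrary
intersections, so a set [D] has an infimum [inf_ideal D].  If [D] is nonempty,
closed and irreducible, this infimum belongs to [D] ([inf_ideal_mem]): were it
outside [D], closedness would give finitely many hulls that cover [D] and miss
the infimum; irreducibility puts [D] inside one of them, say [hull a]; but then
[a] is a lower bound of [D], hence is contained in the infimum, which thus lies
in [hull a] after all.  So [D] has a least element [x]; it is contained in
[hull x], the closure of [x], and contains that closure because it is closed. *)

Set Implicit Arguments.
Unset Strict Implicit.
Unset Printing Implicit Defensive.

Import GRing.Theory.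
Local Open Scope classical_set_scope.
Local Open Scope ring_scope.

(** The definition of irreducibility speaks of two closed sets; finite subbasic
covers require the version for finite families.  Nonemptiness excludes the
empty family. *)
Lemma irreducible_set_cover (T : topologicalType) (I : choiceType) (s : seq I)
    (F : I -> set T) (D : set T) :
  D !=set0 -> irreducible_set D -> (forall i, closed (F i)) ->
  D `<=` \bigcup_(i in [set` s]) F i ->
  exists2 i, i \in s & D `<=` F i.
Proof.
move=> [x0 Dx0] Dirr Fcl; elim: s => [|i s IHs] Ds.
  by have [] := Ds x0 Dx0.
have clU : closed (\bigcup_(j in [set` s]) F j).
  by rewrite bigcup_seq; apply: closed_bigsetU => j _; exact: Fcl.
have [x Dx|DFi|/IHs [j js DFj]] := Dirr _ _ (Fcl i) clU.
- have [j] := Ds x Dx; rewrite /= in_cons => /predU1P [-> ?|js ?]; [by left|].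
  by right; exists j.
- by exists i => //; rewrite mem_head.
- by exists j => //; rewrite in_cons js orbT.
Qed.

Section SemisubtractiveSpace.
Variable S : comNzSemiRingType.
Implicit Types (x y a : semisubtractive_ideal S).
Implicit Types D U : set (semisubtractive_ideal S).

Lemma semisubtractive_ideal_eq x y :
  (x : set S) `<=` y -> (y : set S) `<=` x -> x = y.
Proof.
case: x y => [x xI xS] [y yI yS] /= xy yx.
have exy : x = y by apply/seteqP.
by case: y / exy yI yS {xy yx} => yI yS; congr SemisubtractiveIdeal;
  exact: Prop_irrelevance.
Qed.

(** The complements of hulls are a subbase, so their finite intersections are a
base.  The family is listed by a sequence so that induction applies to it. *)
Lemma open_ideal_nbhs U x : open U -> U x ->
  exists2 s : seq (semisubtractive_ideal S),
    (forall a, a \in s -> ~ hull a x) &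
    forall y, (forall a, a \in s -> ~ hull a y) -> U y.
Proof.
move=> [B sB <-] [V BV Vx].
have [E _ EV] := sB _ BV; exists (finmap.enum_fset E) => [a aE|y yE].
  by have : V x := Vx; rewrite -EV; apply.
have Vy : V y by rewrite -EV => a; exact: yE.
by exists V.
Qed.

Lemma closed_hull a : closed (hull a).
Proof.
rewrite -openC; exists [set ~` hull a]; last by rewrite bigcup_set1.
by move=> _ ->; apply: finI_from1.
Qed.

Lemma closure_ideal x : closure [set x] = hull x.
Proof.
apply/seteqP; split=> [|y xy].
  rewrite [hull x](iffLR (closure_id _) (closed_hull (a:=x))).
  by apply: closureS => _ ->.
move=> B; rewrite nbhsE => -[U [oU Uy] UB]; exists x; split=> //; apply: UB.
have [s sy sU] := open_ideal_nbhs oU Uy.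
by apply: sU => a sa ax; apply: (sy a sa) => z /ax /xy.
Qed.

Lemma is_ideal_bigcap D :
  is_ideal (\bigcap_(a in D) (a : set S)).
Proof.
split=> [a _|u v Du Dv a Da|s u Du a Da]; have [a0 aD aM] := ideal_setP a => //.
- by apply: aD; [apply: Du | apply: Dv].
- by apply: aM; apply: Du.
Qed.

Lemma is_semisubtractive_bigcap D :
  is_semisubtractive (\bigcap_(a in D) (a : set S)).
Proof.
move=> u v uv0 [Du uV].
split; last by exists u; rewrite addrC.
move=> a Da.
by have [] := ideal_set_semisubtractive uv0 (conj (Du a Da) uV).
Qed.

Definition inf_ideal D : semisubtractive_ideal S :=
  SemisubtractiveIdeal (is_ideal_bigcap D) (@is_semisubtractive_bigcap D).

Lemma inf_ideal_lb D : D `<=` hull (inf_ideal D).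
Proof. by move=> a Da u; apply. Qed.

Lemma inf_ideal_glb D a : D `<=` hull a -> hull a (inf_ideal D).
Proof. by move=> Da u au b /Da; apply. Qed.

(** The step where irreducibility acts: a finite cover of [D] by hulls that
misses the infimum would shrink to one hull, and being a hull containing [D] is
exactly being the hull of a lower bound. *)
Lemma inf_ideal_mem D :
  D !=set0 -> irreducible_set D -> closed D -> D (inf_ideal D).
Proof.
move=> D0 Dirr Dcl; apply: contrapT => nDx.
have [s sx sD] := open_ideal_nbhs (closed_openC Dcl) nDx.
have Ds : D `<=` \bigcup_(a in [set` s]) hull a.
  move=> y Dy; apply: contrapT => ns.
  by apply: (sD y) Dy => a sa ay; apply: ns; exists a.
have [a sa Da] := irreducible_set_cover D0 Dirr closed_hull Ds.
exact: sx sa (inf_ideal_glb Da).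
Qed.

End SemisubtractiveSpace.

Theorem theorem2p25 (S : comNzSemiRingType) : sober (semisubtractive_ideal S).
Proof.
move=> D D0 Dirr Dcl; have Dinf := inf_ideal_mem D0 Dirr Dcl.
exists (inf_ideal D); split=> [|y [Dy]].
  split=> //; apply/seteqP; split.
    by rewrite closure_ideal; exact: inf_ideal_lb.
  by rewrite {2}(iffLR (closure_id _) Dcl); apply: closureS => _ ->.
rewrite closure_ideal => Dhull; apply: semisubtractive_ideal_eq.
  exact: inf_ideal_lb.
by move: Dinf; rewrite {1}Dhull.
Qed.
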